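(* Let $C_\psi,C_1,C_2,\ldots$ be $d$-dimensional Archimedean copulas with strict, normalized generators $\psi,\psi_1,\psi_2,\ldots$, respectively. If $(C_n)_{n\in\mathbb{N}}$ converges pointwise to $C_\psi$, then for $\ell\in\{1,\ldots,d-2\}$ and any fixed $\mathbf{x}\in(0,1)^\ell$ it holds that $$\lim_{n\to\infty}C_n^{\mathbf{x}}(\mathbf{u})=C_\psi^{\mathbf{x}}(\mathbf{u})$$ for every $\mathbf{u}\in\mathbb{I}^{d-\ell}$, where $C_n^{\mathbf{x}}$ and $C_\psi^{\mathbf{x}}$ are the conditional copulas of $C_n$ and $C_\psi$.
   Context: $\mathbb{I}=[0,1]$. Archimedean copulas: a generator is a continuous, non-increasing function $\psi:[0,\infty)\to\mathbb{I}$ with $\psi(0)=1$, $\lim_{z\to\infty}\psi(z)=0$, strictly decreasing on $[0,\inf\{z\in[0,\infty]:\psi(z)=0\}]$ (with $\psi(\infty):=0$). $\varphi:(0,1]\to[0,\infty)$ denotes the pseudoinverse of $\psi$, and $\varphi(0):=\inf\{z\in[0,\infty]:\psi(z)=0\}\in(0,\infty]$. A $d$-dimensional copula $C$ is Archimedean with generator $\psi$ if $C(\mathbf{x})=\psi(\varphi(x_1)+\cdots+\varphi(x_d))$ for all $\mathbf{x}\in\mathbb{I}^d$; $C$ (and $\psi$) is strict if $\varphi(0)=\infty$. The right-hand side is a copula if and only if $\psi$ is $d$-monotone: $\psi$ is continuous on $[0,\infty)$, has derivatives $\psi^{(m)}$ up to order $d-2$ on $(0,\infty)$ with $(-1)^m\psi^{(m)}\ge0$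 for $m=0,\ldots,d-2$, and $(-1)^{d-2}\psi^{(d-2)}$ is non-increasing and convex on $(0,\infty)$. A generator is normalized if $\psi(1)=\frac12$. Conditional copula: let $C$ be strict with generator $\psi$, $\ell\in\{1,\ldots,d-2\}$ and $\mathbf{x}\in(0,1)^\ell$. The $\ell$-Markov kernel of $C$ (regular conditional distribution of the last $d-\ell$ coordinates given the first $\ell$) is taken in the version $$K_C(\mathbf{x},[\mathbf{0},\mathbf{y}])=\frac{\psi^{(\ell)}\left(\sum_{i=1}^\ell\varphi(x_i)+\sum_{j=1}^{d-\ell}\varphi(y_j)\right)}{\psi^{(\ell)}\left(\sum_{i=1}^\ell\varphi(x_i)\right)},\qquad \mathbf{y}\in\mathbb{I}^{d-\ell},$$ with $\psi^{(\ell)}(\infty):=0$. Its univariate marginal distribution functions all equal $g_{\mathbf{x}}(y)=\psi^{(\ell)}\left(\sum_{i=1}^\ell\varphi(x_i)+\varphi(y)\right)/\psi^{(\ell)}\left(\sum_{i=1}^\ell\varphi(x_i)\right)$, which is an increasing bijection of $\mathbb{I}$ with inverse $g_{\mathbf{x}}^{-1}$. The conditional copula $C^{\mathbf{x}}$ is the copula of $K_C(\mathbf{x},\cdot)$, i.e. $$C^{\mathbf{x}}(\mathbf{u})=K_C(\mathbf{x},[0,g_{\mathbf{x}}^{-1}(u_1)]\times\cdots\times[0,g_{\mathbf{x}}^{-1}(u_{d-\ell})]),\qquad\mathbf{u}\in\mathbb{I}^{d-\ell}.$$ *)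

(* Defs.v *)
From HB Require Import structures.
From mathcomp Require Import all_boot all_order all_algebra.
From mathcomp Require Import all_classical all_reals all_analysis.

Set Implicit Arguments.
Unset Strict Implicit.
Unset Printing Implicit Defensive.

Import Order.TTheory GRing.Theory Num.Theory.
Import numFieldNormedType.Exports.

Local Open Scope classical_set_scope.
Local Open Scope ring_scope.

Definition in_cube (R : realType) (n : nat) (x : 'I_n -> R) : Prop :=
  forall i, 0 <= x i <= 1.

Definition in_open_cube (R : realType) (n : nat) (x : 'I_n -> R) : Prop :=
  forall i, 0 < x i < 1.

Definition box_volume (R : realType) (d : nat) (C : ('I_d -> R) -> R)
    (a b : 'I_d -> R) : R :=
  \sum_(A : {set 'I_d}) (-1) ^+ #|A| * C (fun i => if i \in A then a i else b i).

(* Only the values of [C] on the unit cube matter. *)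
Definition is_copula (R : realType) (d : nat) (C : ('I_d -> R) -> R) : Prop :=
  [/\ forall x, in_cube x -> (exists i, x i = 0) -> C x = 0,
      forall (i : 'I_d) (t : R), 0 <= t <= 1 ->
        C (fun j => if j == i then t else 1) = t
    & forall a b, in_cube a -> in_cube b -> (forall i, a i <= b i) ->
        0 <= box_volume C a b].

(* Extension of a function on [0, +oo[ to [0, +oo] with the value 0 at +oo;
   the value at -oo is never used. *)
Definition ext0 (R : realType) (f : R -> R) (z : \bar R) : R :=
  if z is r%:E then f r else 0.

(* The pseudoinverse of psi, valued in [0, +oo].  If psi is a generator, then
   for 0 < t <= 1 the set below is the singleton of the preimage of t; for
   t = 0 the infimum is the first zero of psi, or +oo if psi has no zero. *)
Definition varphi (R : realType) (psi : R -> R) (t : R) : \bar R :=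
  ereal_inf [set z : \bar R | (0 <= z)%E /\ ext0 psi z = t].

(* A generator is defined on [0, +oo[ only; psi is arbitrary on the negative
   reals. *)
Definition is_generator (R : realType) (psi : R -> R) : Prop :=
  [/\ forall z : R, 0 <= z -> 0 <= psi z <= 1,
      {within `[0, +oo[, continuous psi},
      forall y z : R, 0 <= y -> y <= z -> psi z <= psi y,
      psi 0 = 1 /\ psi z @[z --> +oo] --> (0 : R)
    & forall y z : \bar R, (0 <= y)%E -> (y < z)%E -> (z <= varphi psi 0)%E ->
        ext0 psi z < ext0 psi y].

Definition strict_generator (R : realType) (psi : R -> R) : Prop :=
  varphi psi 0 = +oo%E.

Definition normalized_generator (R : realType) (psi : R -> R) : Prop :=
  psi 1 = 2^-1.

Definition archimedean_copula (R : realType) (d : nat) (C : ('I_d -> R) -> R)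
    (psi : R -> R) : Prop :=
  [/\ is_copula C, is_generator psi
    & forall x, in_cube x -> C x = ext0 psi (\sum_(i < d) varphi psi (x i))%E].

(* [markov_kernel psi x y] is K_C(x, [0, y]) for the strict Archimedean copula
   C with generator psi, where x has l coordinates and y the remaining m. *)
Definition markov_kernel (R : realType) (psi : R -> R) (l m : nat)
    (x : 'I_l -> R) (y : 'I_m -> R) : R :=
  ext0 (derive1n l psi) (\sum_(i < l) varphi psi (x i)
                   + \sum_(j < m) varphi psi (y j))%E
  / ext0 (derive1n l psi) (\sum_(i < l) varphi psi (x i))%E.

Definition kernel_margin (R : realType) (psi : R -> R) (l : nat)
    (x : 'I_l -> R) (y : R) : R :=
  ext0 (derive1n l psi) (\sum_(i < l) varphi psi (x i) + varphi psi y)%E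
  / ext0 (derive1n l psi) (\sum_(i < l) varphi psi (x i))%E.

(* Inverse of the margin as a bijection of [0, 1]; the default value 0 is
   returned only outside its image. *)
Definition kernel_margin_inv (R : realType) (psi : R -> R) (l : nat)
    (x : 'I_l -> R) : R -> R :=
  'pinv_(fun=> 0) `[0, 1] (kernel_margin psi x).

Definition conditional_copula (R : realType) (psi : R -> R) (l m : nat)
    (x : 'I_l -> R) (u : 'I_m -> R) : R :=
  markov_kernel psi x (fun j => kernel_margin_inv psi x (u j)).

(* Main.v *)
Require Import Defs.
From mathcomp Require Import all_boot all_order all_algebra.
From mathcomp Require Import all_classical all_reals all_analysis.
From mathcomp Require Import ring lra zify.

Set Implicit Arguments.
Unset Strict Implicit.
Unset Printing Implicit Defensive.

Import Order.TTheory GRing.Theory Num.Theory.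
Import numFieldNormedType.Exports.

Local Open Scope classical_set_scope.
Local Open Scope ring_scope.

(** Everything rests on one inequality.  For a strict Archimedean copula with
    generator [psi], the volume of the box with vertices [psi b], [psi (b + h_i)]
    is the [d]-fold alternating difference of [psi], so all [d]-fold alternating
    differences of [psi] on the positive half-line are nonnegative
    ([archimedean_survival]).  Since [psi] vanishes at infinity, so are those
    of lower order ([alternating_pred]); with positivity this makes [psi] a
    function of the class [survival d].

    A function with nonnegative first and second differences is nonincreasing
    and convex, so its rates of decrease [decay f a b] are nonincreasing in
    [a] and in [b] ([decay_nonincreasing]).  With a third order at hand, the
    difference quotients are themselves convex, which bounds the gap between
    left and right quotients linearly in the step: the function is
    differentiable, and minus its derivative is a limit of functions with one
    order less ([survival_opp_derive1]).  Iterating, [(-1)^l psi^(l)] belongs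
    to [survival (d - l)] for [l <= d - 2]: it is positive, convex, continuous,
    strictly decreasing and tends to 0.  Moreover a derivative is squeezed
    between rates of decrease to its left and to its right, so pointwise
    convergence of such functions passes to derivatives
    ([signed_derive_cvg]); being monotone with a continuous limit, these also
    converge along converging arguments ([nonincreasing_cvg_at]), and the
    points where they take converging values converge ([level_cvg]).

    It remains to see that the generators converge ([generator_cvg]).  With all
    but two coordinates equal to 1, convergence of the copulas reads
    [psi_n (phi_n (psi y) + phi_n (psi z)) --> psi (y + z)], where [phi_n] is the
    inverse of [psi_n].  The set of points where [psi_n] converges contains 1
    by normalization; it is stable under sums, because Archimedean copulas are
    1-Lipschitz in each coordinate, and under halving, because diagonals are
    strictly monotone.  Hence it contains all positive dyadic numbers,
    and monotonicity with continuity of [psi] fills the gaps.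

    Finally, with [S] the sum of the [phi (x_i)] and [f = (-1)^l psi^(l)], the
    conditional copula at [u] is [f (S + sum v_j) / f S], where [v_j] solves
    [f (S + v_j) = u_j f S] ([kernel_margin_inv_gt0], [conditional_copulaE]);
    all the ingredients converge.  If some [u_j] is 0, both sides are 0. *)

(** * Alternating finite differences *)

Definition fdiff (R : realType) (h : R) (f : R -> R) : R -> R :=
  fun s => f s - f (s + h).

(** The steps may differ: one step is set aside to form a difference quotient, and
    the remaining ones give the monotonicity and convexity of that quotient. *)
Definition alternating (R : realType) (k : nat) (f : R -> R) : Prop :=
  forall hs : seq R, size hs = k -> all (> 0) hs ->
    forall s, 0 < s -> 0 <= foldr (@fdiff R) f hs s.

Lemma foldr_fdiff_scale (R : realType) (c : R) (f : R -> R) (hs : seq R) (s : R) :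
  foldr (@fdiff R) (fun x => c * f x) hs s = c * foldr (@fdiff R) f hs s.
Proof. by elim: hs s => [//|h hs IH] s /=; rewrite /fdiff !IH mulrBr. Qed.

Lemma foldr_fdiff_cvg (R : realType) (F : nat -> R -> R) (f : R -> R)
    (hs : seq R) : (forall s, 0 < s -> F n s @[n --> \oo] --> f s) ->
  all (> 0) hs -> forall s, 0 < s ->
  foldr (@fdiff R) (F n) hs s @[n --> \oo] --> foldr (@fdiff R) f hs s.
Proof.
move=> Ff; elim: hs => [_|h hs IH /= /andP[h0 hs0] s s0]; first exact: Ff.
by apply: cvgB; apply: IH => //; apply: addr_gt0.
Qed.

Lemma foldr_fdiff_cvg0 (R : realType) (f : R -> R) (hs : seq R) :
  f s @[s --> +oo] --> 0 -> foldr (@fdiff R) f hs s @[s --> +oo] --> 0.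
Proof.
move=> f0; elim: hs => [//|h hs IH] /=.
rewrite -[X in _ --> X](subrr 0); apply: cvgB => //.
apply: (cvg_comp (fun s => s + h)); last exact: IH.
exact: cvg_addrr.
Qed.

(** If [g] is the [k]-fold difference, one more difference being nonnegative says
    [g t <= g s] for [s < t]; letting [t] tend to infinity gives [0 <= g s]. *)
Lemma alternating_pred (R : realType) (k : nat) (f : R -> R) :
  f s @[s --> +oo] --> 0 -> alternating k.+1 f -> alternating k f.
Proof.
move=> f0 fk hs hsk hs0 s s0.
have lim0 := @foldr_fdiff_cvg0 R f hs f0.
have := ler_cvg_to lim0 (cvg_cst (foldr (@fdiff R) f hs s)); apply.
near=> t.
have st : 0 < t - s by rewrite subr_gt0; near: t; apply: nbhs_pinfty_gt; exact: num_real.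
have /= := fk ((t - s) :: hs); rewrite hsk st hs0 => /(_ erefl isT s s0).
by rewrite /fdiff subr_ge0 addrC subrK.
Unshelve. all: by end_near. Qed.

Lemma alternating_le (R : realType) (j k : nat) (f : R -> R) :
  f s @[s --> +oo] --> 0 -> (j <= k)%N -> alternating k f -> alternating j f.
Proof.
move=> f0; elim: k => [|k IH]; first by rewrite leqn0 => /eqP->.
by rewrite leq_eqVlt => /predU1P[->//|jk /alternating_pred-/(_ f0)]; apply: IH.
Qed.

Lemma alternating_scale (R : realType) (k : nat) (c : R) (f : R -> R) :
  0 <= c -> alternating k f -> alternating k (fun x => c * f x).
Proof.
by move=> c0 fk hs hsk hs0 s s0; rewrite foldr_fdiff_scale mulr_ge0 ?fk.
Qed.

Lemma alternating_fdiff (R : realType) (k : nat) (h : R) (f : R -> R) :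
  0 < h -> alternating k.+1 f -> alternating k (fdiff h f).
Proof.
move=> h0 fk hs hsk hs0 s s0; rewrite -(foldr_rcons (@fdiff R)).
by apply: fk => //; rewrite ?size_rcons ?hsk// all_rcons h0.
Qed.

Lemma alternating_cvg (R : realType) (k : nat) (F : nat -> R -> R) (f : R -> R) :
  (forall s, 0 < s -> F n s @[n --> \oo] --> f s) ->
  (forall n, alternating k (F n)) -> alternating k f.
Proof.
move=> Ff Fk hs hsk hs0 s s0.
have := ler_cvg_to (cvg_cst (0 : R)) (foldr_fdiff_cvg Ff hs0 s0); apply.
by near=> n; apply: Fk.
Unshelve. all: by end_near. Qed.

Lemma alternating1_ge (R : realType) (f : R -> R) : alternating 1 f ->
  forall s t, 0 < s -> s <= t -> f t <= f s.
Proof.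
move=> f1 s t s0; rewrite le_eqVlt => /predU1P[->//|st].
have := f1 [:: t - s] erefl; rewrite /= subr_gt0 st => /(_ isT s s0).
by rewrite /fdiff subr_ge0 addrC subrK.
Qed.

Lemma alternating2_ge (R : realType) (f : R -> R) : alternating 2 f ->
  forall h s t, 0 < h -> 0 < s -> s <= t -> fdiff h f t <= fdiff h f s.
Proof.
move=> f2 h s t h0; apply: alternating1_ge.
exact: alternating_fdiff.
Qed.

(** * Convexity from second differences *)

(** The [n]-th increment [fdiff a f (s + n a)] is at most each of the earlier
    ones, hence at most the average of the first [j]. *)
Lemma alternating2_chord_grid (R : realType) (f : R -> R) (a s : R) (m N : nat) :
  alternating 2 f -> 0 < a -> 0 < s -> (m <= N)%N ->
  m%:R * (f s - f (s + N%:R * a)) <= N%:R * (f s - f (s + m%:R * a)).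
Proof.
move=> f2 a0 s0.
have step j n : (j <= n)%N ->
    j%:R * fdiff a f (s + n%:R * a) <= f s - f (s + j%:R * a).
  elim: j => [|j IH] jn; first by rewrite !mul0r addr0 subrr.
  have := IH (ltnW jn).
  have /(_ (s + j%:R * a) (s + n%:R * a)) := alternating2_ge f2 a0.
  rewrite ltr_wpDr ?mulr_ge0 ?(ltW a0)// lerD2l ler_pM2r// ler_nat (ltnW jn).
  move=> /(_ isT isT).
  have -> : s + j.+1%:R * a = s + j%:R * a + a by rewrite -natr1; ring.
  rewrite -natr1 /fdiff; lra.
elim: N => [|N IH]; first by rewrite leqn0 => /eqP->; rewrite mul0r.
rewrite leq_eqVlt => /predU1P[->//|]; rewrite ltnS => mN.
have := step _ _ mN; have := IH mN; rewrite /fdiff.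
have -> : s + N.+1%:R * a = s + N%:R * a + a by rewrite -natr1; ring.
rewrite -natr1; lra.
Qed.

(** Monotonicity replaces continuity in passing from commensurable to arbitrary
    steps: [H] is rounded up to a multiple of [h / m], which costs a relative
    error that vanishes as [m] grows. *)
Lemma alternating2_chord (R : realType) (f : R -> R) (s h H : R) :
  alternating 1 f -> alternating 2 f -> 0 < s -> 0 < h -> h <= H ->
  h * (f s - f (s + H)) <= H * (f s - f (s + h)).
Proof.
move=> f1 f2 s0 h0 hH; rewrite leNgt; apply/negP => ltHh.
set X := f s - f (s + H) in ltHh; set Y := f s - f (s + h) in ltHh.
have e0 : 0 < h * X - H * Y by rewrite subr_gt0.
have Y0 : 0 <= Y by rewrite subr_ge0 (alternating1_ge f1)// lerDl ltW.
(* [m] is so large that the rounding error, at most [h * Y / m], is below the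
   assumed violation [h * X - H * Y]. *)
set m := (Num.truncn (h * Y / (h * X - H * Y))).+1.
have hm : h * Y < m%:R * (h * X - H * Y).
  by rewrite -ltr_pdivrMr//; exact: truncnS_gt.
have m0 : 0 < m%:R :> R by rewrite ltr0n.
set a := h / m%:R.
have a0 : 0 < a by rewrite divr_gt0.
have H0 : 0 < H by exact: lt_le_trans hH.
have /andP[N1 N2] := truncn_itv (ltW (divr_gt0 H0 a0)).
set N := (Num.truncn (H / a)).+1 in N2.
have NH : H <= N%:R * a by rewrite -ler_pdivrMr// ltW.
have ma : m%:R * a = h by rewrite /a mulrC divfK// gt_eqF.
have N1' : N%:R * a <= H + a.
  by rewrite /N -natr1 mulrDl mul1r lerD2r -ler_pdivlMr.
have mN : (m <= N)%N.
  by rewrite -(ler_nat R) -(ler_pM2r a0) ma (le_trans hH).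
have := alternating2_chord_grid f2 a0 s0 mN; rewrite ma -/Y => grid.
have XN : X <= f s - f (s + N%:R * a).
  rewrite /X lerD2l lerN2; apply: (alternating1_ge f1); last by rewrite lerD2l.
  by rewrite addr_gt0.
have : m%:R * X <= N%:R * Y by apply: le_trans grid; rewrite ler_pM2l.
rewrite -(ler_pM2l a0) !mulrA [a * m%:R]mulrC ma [a * N%:R]mulrC => hX.
have : h * X <= (H + a) * Y by apply: (le_trans hX); rewrite ler_wpM2r.
rewrite -(ler_pM2l m0).
have -> : m%:R * ((H + a) * Y) = m%:R * H * Y + m%:R * a * Y by ring.
rewrite ma; lra.
Qed.

(** Minus the slope of a chord; [decayC] makes one formula serve for increments
    of either sign. *)
Definition decay (R : realType) (f : R -> R) (a b : R) : R :=
  (f a - f b) / (b - a).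

Lemma decayC (R : realType) (f : R -> R) (a b : R) : decay f a b = decay f b a.
Proof. by rewrite /decay -[b - a]opprB invrN mulrN -mulNr opprB. Qed.

Lemma decay_fdiff (R : realType) (f : R -> R) (h s : R) :
  decay f s (s + h) = h^-1 * fdiff h f s.
Proof. by rewrite /decay /fdiff addrAC subrr add0r mulrC. Qed.

Lemma decay_ge0 (R : realType) (f : R -> R) (a b : R) : alternating 1 f ->
  0 < a -> a < b -> 0 <= decay f a b.
Proof.
move=> f1 a0 ab; rewrite divr_ge0 ?subr_ge0 ?(ltW ab)//.
exact: (alternating1_ge f1) (ltW ab).
Qed.

Lemma decay_nonincreasing (R : realType) (f : R -> R) (a b a' b' : R) :
  alternating 1 f -> alternating 2 f -> 0 < a -> a < b -> a' < b' ->
  a <= a' -> b <= b' -> decay f a' b' <= decay f a b.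
Proof.
move=> f1 f2 a0 ab ab' aa' bb'.
have ab'' : a < b' by exact: lt_le_trans bb'.
have chord c e : a < c -> c <= e ->
    (c - a) * (f a - f e) <= (e - a) * (f a - f c).
  move=> ac ce.
  have := alternating2_chord f1 f2 a0 _ _.
  move=> /(_ (c - a) (e - a)); rewrite subr_gt0 lerD2r !subrKC; exact.
apply: (@le_trans _ _ (decay f a b')); last first.
  rewrite /decay ler_pdivrMr ?subr_gt0// mulrAC ler_pdivlMr ?subr_gt0//.
  have := chord _ _ ab bb'; lra.
move: aa'; rewrite le_eqVlt => /predU1P[->//|aa'].
rewrite /decay ler_pdivrMr ?subr_gt0// mulrAC ler_pdivlMr ?subr_gt0//.
have := chord _ _ aa' (ltW ab'); lra.
Qed.

Lemma decay_cvg (R : realType) (F : nat -> R -> R) (f : R -> R) (a b : R) :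
  F n a @[n --> \oo] --> f a -> F n b @[n --> \oo] --> f b ->
  decay (F n) a b @[n --> \oo] --> decay f a b.
Proof. by move=> Fa Fb; apply: cvgM; [exact: cvgB|exact: cvg_cst]. Qed.

(** The derivative is found without limits, as the supremum [g] of the rates of
    decrease to the right of [s].  The quotient [q x = fdiff h f x / h] is convex
    because one more difference of [f] is controlled, so
    [q (s - h) - q s] is at most [h] times the decay of [q] on [s / 2, s]; as [q]
    is bounded there uniformly in [h], left and right quotients at [s] differ
    by at most [K * h], and [g] lies between them. *)
Lemma alternating3_slope (R : realType) (f : R -> R) (s : R) :
  alternating 1 f -> alternating 2 f -> alternating 3 f -> 0 < s ->
  exists g K : R,
    [/\ 0 <= K,
        forall r t, 0 < r -> r < s -> s < t -> decay f s t <= g <= decay f r s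
      & forall h, h != 0 -> `|h| < s / 2 -> `|decay f s (s + h) - g| <= K * `|h|].
Proof.
move=> f1 f2 f3 s0.
have dec := @decay_nonincreasing R f _ _ _ _ f1 f2.
set E := [set decay f s t | t in [set t | s < t]].
have Es1 : E (decay f s (s + 1)) by exists (s + 1) => //=; rewrite ltrDl.
have Eub r : 0 < r -> r < s -> ubound E (decay f r s).
  by move=> r0 rs _ [t /= st <-]; apply: dec => //; exact: ltW.
have s2 : 0 < s / 2 by rewrite divr_gt0.
have s2s : s / 2 < s by lra.
have hsE : has_sup E by split; [exists (decay f s (s + 1))|
  exists (decay f (s / 2) s); exact: Eub].
have gP r t : 0 < r -> r < s -> s < t -> decay f s t <= sup E <= decay f r s.
  move=> r0 rs st; apply/andP; split.
    by apply: ub_le_sup; [case: hsE|exists t].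
  by apply: ge_sup; [case: hsE|exact: Eub].
pose K := (decay f (s / 4) (s / 2)) / (s / 2).
exists (sup E), K; split => //.
  by rewrite divr_ge0 ?(ltW s2)// decay_ge0//; lra.
have key h : 0 < h -> h < s / 2 ->
    decay f (s - h) s <= decay f s (s + h) + K * h.
  move=> h0 hs.
  pose q x := h^-1 * fdiff h f x.
  have hV : 0 <= h^-1 by rewrite invr_ge0 ltW.
  have q1 : alternating 1 q by apply: alternating_scale => //; exact: alternating_fdiff.
  have q2 : alternating 2 q by apply: alternating_scale => //; exact: alternating_fdiff.
  have sh : s / 2 < s - h by lra.
  have : decay q (s - h) s <= decay q (s / 2) s.
    by apply: decay_nonincreasing; rewrite //; lra.
  have q0 : 0 <= q s.
    rewrite mulr_ge0// subr_ge0; apply: (alternating1_ge f1) => //; lra.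
  have qs2 : q (s / 2) <= decay f (s / 4) (s / 2).
    by rewrite /q -decay_fdiff; apply: dec; lra.
  rewrite {1}/decay opprB subrKC ler_pdivrMr//.
  have -> : q (s - h) = decay f (s - h) s by rewrite /q -decay_fdiff subrK.
  have -> : q s = decay f s (s + h) by rewrite /q -decay_fdiff.
  move=> H.
  rewrite -lerBlDl; apply: (le_trans H); rewrite ler_pM2r// /decay /K.
  have -> : s - s / 2 = s / 2 by lra.
  by rewrite ler_pM2r ?invr_gt0//; move: qs2 q0; rewrite /decay; lra.
move=> h hn0 hs; have [h0|h0] := ltP 0 h.
  rewrite gtr0_norm// in hs *.
  have /andP[A B] : decay f s (s + h) <= sup E <= decay f (s - h) s.
    by apply: gP; lra.
  have := key _ h0 hs; rewrite ler_norml; lra.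
have {}h0 : 0 < - h by rewrite oppr_gt0 lt_neqAle hn0.
rewrite ltr0_norm -?oppr_gt0// in hs *.
have /andP[A B] : decay f s (s - h) <= sup E <= decay f (s + h) s.
  by apply: gP; lra.
have := key _ h0 hs; rewrite opprK [decay f s (s + h)]decayC ler_norml; lra.
Qed.

Lemma slope_bound_is_derive (R : realType) (f : R -> R) (s g K : R) :
  0 < s -> 0 <= K ->
  (forall h, h != 0 -> `|h| < s / 2 -> `|decay f s (s + h) - g| <= K * `|h|) ->
  is_derive s 1 f (- g).
Proof.
move=> s0 K0 slope.
suff H : h^-1 *: (f (h *: 1 + s) - f s) @[h --> 0^'] --> - g.
  by split; [apply/cvg_ex; exists (- g)|exact: cvg_lim].
apply/cvgrPdist_le => e e0.
near=> h.
have hn0 : h != 0 by near: h; exact: nbhs_dnbhs_neq.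
have hs : `|h| < s / 2.
  near: h; apply: dnbhs0_lt; lra.
have he : `|h| < e / (K + 1).
  near: h; apply: dnbhs0_lt; rewrite divr_gt0//; lra.
apply: le_trans (_ : K * `|h| <= _).
  have -> : - g - h^-1 *: (f (h *: 1 + s) - f s) = decay f s (s + h) - g.
    rewrite decay_fdiff /fdiff -[h *: 1]/(h * 1) mulr1 [h + s]addrC.
    by rewrite -[_ *: _]/(_ * _); lra.
  exact: slope.
move: he; rewrite ltr_pdivlMr; last by lra.
by have := normr_ge0 h; lra.
Unshelve. all: by end_near. Qed.

(** * Functions with alternating differences that vanish at infinity *)

(** Up to normalization, these are the survival functions of the [k]-monotone
    laws on the half-line. *)
Definition survival (R : realType) (k : nat) (f : R -> R) : Prop :=
  [/\ alternating k f, forall s, 0 < s -> 0 < f s & f s @[s --> +oo] --> 0].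

Lemma survival_alternating (R : realType) (j k : nat) (f : R -> R) :
  survival k f -> (j <= k)%N -> alternating j f.
Proof. by case=> fk _ f0 jk; exact: alternating_le fk. Qed.

Lemma survival_le (R : realType) (k : nat) (f : R -> R) (a b : R) :
  survival k.+1 f -> 0 < a -> a <= b -> f b <= f a.
Proof. by move=> fk; apply/alternating1_ge/(survival_alternating fk). Qed.

(** If [f b = f a], convexity forbids any decrease after [b], against the limit 0
    at infinity and [0 < f a]. *)
Lemma survival_lt (R : realType) (k : nat) (f : R -> R) (a b : R) :
  survival k.+2 f -> 0 < a -> a < b -> f b < f a.
Proof.
move=> fk a0 ab; have [_ fpos f0] := fk.
rewrite lt_neqAle (survival_le fk a0 (ltW ab)) andbT; apply/eqP => fba.
have : f a <= 0; last by rewrite leNgt fpos.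
have := ler_cvg_to (cvg_cst (f a)) f0; apply.
near=> c.
have bc : b < c by near: c; apply: nbhs_pinfty_gt; exact: num_real.
have H : decay f a c <= decay f a b.
  apply: decay_nonincreasing => //; last exact: lt_trans ab bc.
  - exact: survival_alternating fk _.
  - exact: survival_alternating fk _.
move: H; rewrite {2}/decay fba subrr mul0r /decay pmulr_lle0 ?subr_le0//.
by rewrite invr_gt0 subr_gt0 (lt_trans ab).
Unshelve. all: by end_near. Qed.

Lemma survival_decay (R : realType) (k : nat) (f : R -> R) (a b a' b' : R) :
  survival k.+2 f -> 0 < a -> a < b -> a' < b' ->
  a <= a' -> b <= b' -> decay f a' b' <= decay f a b.
Proof.
by move=> fk; apply: decay_nonincreasing; exact: survival_alternating fk _.
Qed.

Lemma survival_continuous (R : realType) (k : nat) (f : R -> R) (s : R) :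
  survival k.+2 f -> 0 < s -> {for s, continuous f}.
Proof.
move=> fk s0; apply/cvgrPdist_le => e e0.
set K := decay f (s / 4) (s / 2).
have K0 : 0 <= K.
  by apply: decay_ge0; [exact: survival_alternating fk _|lra|lra].
have ids : t @[t --> s] --> s by exact: cvg_id.
near=> t.
have ts : s / 2 < t by near: t; apply: (cvgr_gt _ ids); lra.
have te : `|s - t| < e / (K + 1).
  near: t; move/cvgrPdist_lt: ids; apply; rewrite divr_gt0//; lra.
apply: le_trans (_ : K * `|s - t| <= _); last first.
  by move: te; rewrite ltr_pdivlMr; [have := normr_ge0 (s - t); lra|lra].
have [->|st] := eqVneq s t; first by rewrite !subrr normr0 mulr0.
rewrite -ler_pdivrMr ?normr_gt0 ?subr_eq0// -normrV ?unitfE ?subr_eq0//.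
rewrite -normrM -[_ * _]opprK -mulrN -invrN opprB normrN -/(decay f s t).
have D : 0 <= decay f s t <= K.
  move: st; rewrite neq_lt => /orP[st|st]; last rewrite decayC.
    rewrite decay_ge0//; last exact: survival_alternating fk _.
    by apply: (survival_decay fk) => //; lra.
  rewrite decay_ge0//; [|exact: survival_alternating fk _|lra].
  by apply: (survival_decay fk) => //; lra.
by case/andP: D => D1 D2; rewrite ger0_norm.
Unshelve. all: by end_near. Qed.

(** The margins of the Markov kernel are onto for this reason: [f] is continuous
    and falls from [f s] to 0. *)
Lemma survival_onto (R : realType) (k : nat) (f : R -> R) (s u : R) :
  survival k.+2 f -> 0 < s -> 0 < u <= 1 -> exists2 v, 0 <= v & f (s + v) = u * f s.
Proof.
move=> fk s0 /andP[u0 u1]; have [_ fpos f0] := fk.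
have [T sT fT] : exists2 T, s < T & f T < u * f s.
  near (pinfty_nbhs R) => T; exists T.
    by near: T; apply: nbhs_pinfty_gt; exact: num_real.
  by near: T; apply: (cvgr_lt _ f0); rewrite mulr_gt0// fpos.
have fTs := survival_le fk s0 (ltW sT).
have [|||c] := @IVT R f s T (u * f s); first exact: ltW.
- apply: continuous_in_subspaceT => x; rewrite inE/= in_itv/= => /andP[sx _].
  by apply: survival_continuous fk _; exact: lt_le_trans sx.
- rewrite (min_idPr fTs) (max_idPl fTs) (ltW fT)/=.
  by rewrite ler_piMl// ltW// fpos.
rewrite in_itv/= => /andP[sc _] fc; exists (c - s); first by rewrite subr_ge0.
by rewrite subrKC.
Unshelve. all: by end_near. Qed.

Lemma survival_slope (R : realType) (k : nat) (f : R -> R) (s : R) :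
  survival k.+3 f -> 0 < s -> exists K : R,
    [/\ 0 <= K, derivable f s 1,
        forall r t, 0 < r -> r < s -> s < t ->
          decay f s t <= - derive1 f s <= decay f r s
      & forall h, h != 0 -> `|h| < s / 2 ->
          `|decay f s (s + h) - - derive1 f s| <= K * `|h|].
Proof.
move=> fk s0.
have [|||g [K [K0 gP gK]]] := @alternating3_slope R f s _ _ _ s0.
- exact: survival_alternating fk _.
- exact: survival_alternating fk _.
- exact: survival_alternating fk _.
have fD := slope_bound_is_derive s0 K0 gK.
have -> : derive1 f s = - g by rewrite derive1E; apply: derive_val.
by exists K; rewrite opprK; split.
Qed.

(** Minus the derivative is the limit of the quotients
    [fdiff (1 / n) f s * n], which have one order less.  Its positivity
    and its limit at infinity come from the squeeze between the rates of
    decrease on [s, s + 1] and on [s - 1, s]. *)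
Lemma survival_opp_derive1 (R : realType) (k : nat) (f : R -> R) :
  survival k.+3 f -> survival k.+2 (fun s => - derive1 f s).
Proof.
move=> fk; have [fa fpos f0] := fk.
have pos s : 0 < s -> 0 < - derive1 f s.
  move=> s0; have [K [_ _ sq _]] := survival_slope fk s0.
  have /andP[H _] : decay f s (s + 1) <= - derive1 f s <= decay f (s / 2) s.
    by apply: sq; lra.
  apply: lt_le_trans H; rewrite divr_gt0// subr_gt0 ?ltrDl//.
  by apply: (survival_lt fk s0); rewrite ltrDl.
split => //.
- pose F (n : nat) := fun s => (n.+1%:R^-1)^-1 * fdiff (n.+1%:R^-1) f s.
  apply: (@alternating_cvg _ _ F) => [s s0|n]; last first.
    by apply: alternating_scale => //; exact: alternating_fdiff.
  have [K [_ _ _ sK]] := survival_slope fk s0.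
  have h0 := @cvg_harmonic R.
  apply/cvgrPdist_le.
  have Kh : K * harmonic n @[n --> \oo] --> 0.
    by rewrite -[X in _ --> X](mulr0 K); apply: cvgM => //; exact: cvg_cst.
  move=> e e0; near=> n.
  rewrite distrC /F -decay_fdiff; apply: le_trans (sK _ _ _) _ => //.
    by rewrite gtr0_norm//; near: n; apply: (cvgr_lt _ h0); lra.
  by rewrite gtr0_norm//; apply: ltW; near: n; apply: (cvgr_lt _ Kh).
- apply: (@squeeze_cvgr _ _ _ _ (fun=> 0) (fun s => f (s - 1))).
  + near=> s.
    have s1 : 1 < s by near: s; apply: nbhs_pinfty_gt; exact: num_real.
    have s0 : 0 < s by lra.
    rewrite ltW ?pos//=; have [K [_ _ sq _]] := survival_slope fk s0.
    have /andP[_ H] : decay f s (s + 1) <= - derive1 f s <= decay f (s - 1) s.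
      by apply: sq; lra.
    apply: (le_trans H); rewrite /decay opprB subrKC divr1.
    by have := fpos _ s0; lra.
  + exact: cvg_cst.
  + apply: (cvg_comp (fun s => s - 1)); last exact: f0.
    exact: cvg_addrr.
Unshelve. all: by end_near. Qed.

(** The derivatives of [F n] and of [f] at [s] lie between the rates of decrease
    on [s, s + h] and on [s - h, s].  For fixed [h] those of [F n] converge to
    those of [f], and the latter differ from the derivative by at most [K * h]. *)
Lemma survival_cvg_derive1 (R : realType) (k : nat) (F : nat -> R -> R) (f : R -> R) :
  (forall n, survival k.+3 (F n)) -> survival k.+3 f ->
  (forall s, 0 < s -> F n s @[n --> \oo] --> f s) ->
  forall s, 0 < s -> - derive1 (F n) s @[n --> \oo] --> - derive1 f s.
Proof.
move=> Fk fk Ff s s0; have [K [K0 _ _ sK]] := survival_slope fk s0.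
apply/cvgrPdist_le => e e0.
pose h := Num.min (s / 4) (e / 2 / (K + 1)).
have h0 : 0 < h by rewrite lt_min !divr_gt0//; lra.
have hs : h <= s / 4 by rewrite ge_min lexx.
have he : K * h <= e / 2.
  have : h <= e / 2 / (K + 1) by rewrite ge_min lexx orbT.
  by rewrite ler_pdivlMr; lra.
have := sK h; rewrite gt_eqF// gtr0_norm// => /(_ isT).
have -> : h < s / 2 by lra.
move=> /(_ isT); rewrite ler_norml => /andP[A _].
have := sK (- h); rewrite oppr_eq0 gt_eqF// normrN gtr0_norm// => /(_ isT).
have -> : h < s / 2 by lra.
move=> /(_ isT); rewrite ler_norml decayC => /andP[_ B].
have sh0 : 0 < s + h by lra.
have sh1 : 0 < s - h by lra.
have D1 := decay_cvg (Ff _ s0) (Ff _ sh0).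
have D2 := decay_cvg (Ff _ sh1) (Ff _ s0).
near=> n.
have [Kn [_ _ sq _]] := survival_slope (Fk n) s0.
have /andP[E1 E2] : decay (F n) s (s + h) <= - derive1 (F n) s <= decay (F n) (s - h) s.
  by apply: sq; lra.
have C1 : decay f s (s + h) - e / 2 < decay (F n) s (s + h).
  by near: n; apply: (cvgr_gt _ D1); lra.
have C2 : decay (F n) (s - h) s < decay f (s - h) s + e / 2.
  by near: n; apply: (cvgr_lt _ D2); lra.
rewrite ler_norml; lra.
Unshelve. all: by end_near. Qed.

(** * Derivatives of higher order *)

Definition signed_derive (R : realType) (l : nat) (f : R -> R) : R -> R :=
  fun s => (-1) ^+ l * derive1n l f s.

Lemma signed_deriveS (R : realType) (k l : nat) (f : R -> R) (s : R) :
  survival k.+3 (signed_derive l f) -> 0 < s ->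
  signed_derive l.+1 f s = - derive1 (signed_derive l f) s.
Proof.
move=> fk s0; have [K [_ fD _ _]] := survival_slope fk s0.
have E : derive1n l f = fun x => (-1) ^+ l * signed_derive l f x.
  by apply/funext => x; rewrite /signed_derive signrMK.
by rewrite {1}/signed_derive derive1nS {1}E derive1Ml// exprS mulN1r mulNr signrMK.
Qed.

Lemma eq_survival (R : realType) (k : nat) (f g : R -> R) :
  (forall s, 0 < s -> f s = g s) -> survival k f -> survival k g.
Proof.
move=> fg [fk fpos f0]; split.
- by apply: (@alternating_cvg _ _ (fun=> f)) => // s s0; rewrite -fg//; exact: cvg_cst.
- by move=> s s0; rewrite -fg// fpos.
- apply: cvg_trans f0; apply: near_eq_cvg; near=> s; apply: fg.
  by near: s; apply: nbhs_pinfty_gt; exact: num_real.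
Unshelve. all: by end_near. Qed.

Lemma survival_signed_derive (R : realType) (k l : nat) (f : R -> R) :
  survival (l + k.+2) f -> survival k.+2 (signed_derive l f).
Proof.
elim: l k => [|l IH] k; first by apply: eq_survival => s _; rewrite /signed_derive mul1r.
rewrite addSnnS => /IH fk; have := survival_opp_derive1 fk.
by apply: eq_survival => s s0; rewrite (signed_deriveS fk).
Qed.

Lemma signed_derive_cvg (R : realType) (k l : nat) (F : nat -> R -> R) (f : R -> R) :
  (forall n, survival (l + k.+2) (F n)) -> survival (l + k.+2) f ->
  (forall s, 0 < s -> F n s @[n --> \oo] --> f s) ->
  forall s, 0 < s -> signed_derive l (F n) s @[n --> \oo] --> signed_derive l f s.
Proof.
elim: l k => [|l IH] k Fk fk Ff s s0.
  rewrite /signed_derive mul1r; under eq_fun do rewrite mul1r; exact: Ff.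
have Fk' n : survival k.+3 (signed_derive l (F n)).
  by apply: survival_signed_derive; rewrite -addSnnS.
have fk' : survival k.+3 (signed_derive l f).
  by apply: survival_signed_derive; rewrite -addSnnS.
rewrite (signed_deriveS fk')//.
under eq_fun do rewrite (signed_deriveS (Fk' _))//.
apply: (survival_cvg_derive1 Fk' fk') => //.
by apply: (IH k.+1) => //; rewrite -addSnnS.
Qed.

(** * Convergence of monotone functions along converging arguments *)

Lemma continuous_bracket (R : realType) (f : R -> R) (s e : R) :
  {for s, continuous f} -> 0 < s -> 0 < e ->
  exists h, [/\ 0 < h, h < s, `|f s - f (s - h)| < e & `|f s - f (s + h)| < e].
Proof.
move=> fc s0 e0.
have /cvgrPdist_lt/(_ _ e0)/nbhs_ballP[r /= r0 rP] := fc.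
pose h := Num.min (s / 2) (r / 2).
have h0 : 0 < h by rewrite lt_min !divr_gt0.
have hs : h <= s / 2 by rewrite ge_min lexx.
have hr : h <= r / 2 by rewrite ge_min lexx orbT.
exists h; split => //; first by lra.
- by apply: rP; rewrite /ball/= opprB subrKC gtr0_norm//; lra.
- by apply: rP; rewrite /ball/= opprD addNKr normrN gtr0_norm//; lra.
Qed.

(** [F n (s_ n)] is squeezed between [F n (s + h)] and [F n (s - h)], whose limits
    are close to [f s]. *)
Lemma nonincreasing_cvg_at (R : realType) (F : nat -> R -> R) (f : R -> R)
    (s_ : nat -> R) (s : R) :
  (forall n a b, 0 < a -> a <= b -> F n b <= F n a) ->
  (forall a, 0 < a -> F n a @[n --> \oo] --> f a) ->
  {for s, continuous f} -> 0 < s -> s_ n @[n --> \oo] --> s ->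
  F n (s_ n) @[n --> \oo] --> f s.
Proof.
move=> Fle Ff fc s0 ss; apply/cvgrPdist_le => e e0.
have e2 : 0 < e / 2 by lra.
have [h [h0 hs]] := continuous_bracket fc s0 e2.
rewrite !ltr_norml => /andP[B1 B2] /andP[A1 A2].
have a0 : 0 < s - h by lra.
have b0 : 0 < s + h by lra.
near=> n.
have N1 : s - h < s_ n by near: n; apply: (cvgr_gt _ ss); lra.
have N2 : s_ n < s + h by near: n; apply: (cvgr_lt _ ss); lra.
have N3 : F n (s - h) < f s + e by near: n; apply: (cvgr_lt _ (Ff _ a0)); lra.
have N4 : f s - e < F n (s + h) by near: n; apply: (cvgr_gt _ (Ff _ b0)); lra.
have := Fle n _ _ a0 (ltW N1).
have := Fle n (s_ n) _ (lt_trans a0 N1) (ltW N2).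
rewrite ler_norml; lra.
Unshelve. all: by end_near. Qed.

(** This serves both for the inverses of the generators and for the inverses of
    the margins; the levels [F n (w_ n)] may vary with [n]. *)
Lemma level_cvg (R : realType) (F : nat -> R -> R) (f : R -> R)
    (w_ : nat -> R) (w : R) :
  (forall n a b, 0 < a -> a <= b -> F n b <= F n a) ->
  (forall a b, 0 < a -> a < b -> f b < f a) ->
  (forall a, 0 < a -> F n a @[n --> \oo] --> f a) ->
  (forall n, 0 < w_ n) -> 0 < w ->
  F n (w_ n) @[n --> \oo] --> f w -> w_ n @[n --> \oo] --> w.
Proof.
move=> Fle flt Ff wn0 w0 Fw; apply/cvgrPdist_le => e e0.
pose h := Num.min (w / 2) e.
have h0 : 0 < h by rewrite lt_min e0 divr_gt0.
have hw : h <= w / 2 by rewrite ge_min lexx.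
have he : h <= e by rewrite ge_min lexx orbT.
have a0 : 0 < w - h by lra.
have b0 : 0 < w + h by lra.
have A : f w < f (w - h) by apply: flt => //; lra.
have B : f (w + h) < f w by apply: flt => //; lra.
pose mA := (f w + f (w - h)) / 2. pose mB := (f w + f (w + h)) / 2.
near=> n.
have N1 : F n (w_ n) < mA by near: n; apply: (cvgr_lt _ Fw); rewrite /mA; lra.
have N2 : mA < F n (w - h) by near: n; apply: (cvgr_gt _ (Ff _ a0)); rewrite /mA; lra.
have N3 : mB < F n (w_ n) by near: n; apply: (cvgr_gt _ Fw); rewrite /mB; lra.
have N4 : F n (w + h) < mB by near: n; apply: (cvgr_lt _ (Ff _ b0)); rewrite /mB; lra.
have L : w - h < w_ n.
  rewrite ltNge; apply/negP => H; have := Fle n _ _ (wn0 n) H; lra.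
have U : w_ n < w + h.
  rewrite ltNge; apply/negP => H; have := Fle n _ _ b0 H; lra.
rewrite ler_norml; lra.
Unshelve. all: by end_near. Qed.

(** * Generators of strict Archimedean copulas *)

(** Each step [h i] is either skipped or taken, with a sign for each one taken:
    this is the sum over vertices in the volume of a box. *)
Lemma foldr_fdiff_setE (R : realType) (T : finType) (h : T -> R) (f : R -> R)
    (r : seq T) (s : R) : uniq r ->
  foldr (@fdiff R) f (map h r) s =
  \sum_(A : {set T} | A \subset r) (-1) ^+ #|A| * f (s + \sum_(i in A) h i).
Proof.
elim: r s => [|i r IH] s /=.
  rewrite (big_pred1 finset.set0) => [|A]; last first.
    by rewrite /= -finset.subset0; apply/idP/idP => /fintype.subsetP H;
    apply/fintype.subsetP => x /H; rewrite inE.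
  by rewrite cards0 big_set0 addr0 mul1r.
move=> /andP[ir ur]; rewrite /fdiff !IH// -sumrN.
rewrite [RHS](bigID (fun A : {set T} => i \in A))/= [RHS]addrC; congr (_ + _).
  apply: eq_bigl => A; apply/idP/andP => [Ar|[Air iA]].
    split; first by apply: fintype.subset_trans Ar _; apply/fintype.subsetP => j; rewrite inE orbC => ->.
    by apply: contra ir => /(fintype.subsetP Ar).
  apply/fintype.subsetP => j jA; have := fintype.subsetP Air j jA; rewrite inE => /predU1P[ji|//].
  by rewrite -ji jA in iA.
rewrite [RHS](reindex_onto (fun A => i |: A) (fun A => A :\ i))/=; last first.
  by move=> A /andP[_ iA]; rewrite finset.setD1K.
apply: eq_big => [A|A Ar].
  apply/idP/andP => [Ar|[/andP[Air _] /eqP AE]].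
    have iA : i \notin A by apply: contra ir => /(fintype.subsetP Ar).
    rewrite finset.setU1K// eqxx finset.setU11 andbT; split => //.
    by apply/fintype.subsetP => j; rewrite !inE => /predU1P[->|/(fintype.subsetP Ar)->]; rewrite ?eqxx ?orbT.
  have iA : i \notin A by rewrite -AE !inE eqxx.
  apply/fintype.subsetP => j jA; have := fintype.subsetP Air j; rewrite !inE jA orbT => /(_ isT).
  by case/predU1P => // ji; rewrite -ji jA in iA.
have iA : i \notin A by apply: contra ir => /(fintype.subsetP Ar).
by rewrite cardsU1 iA big_setU1//= exprD expr1 mulN1r mulNr addrA.
Qed.

Section generator.
Variables (R : realType) (psi : R -> R).
Hypothesis psi_gen : is_generator psi.
Hypothesis psi_strict : strict_generator psi.

Lemma generator_lt (y z : R) : 0 <= y -> y < z -> psi z < psi y.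
Proof.
case: psi_gen => _ _ _ _ H y0 yz.
by apply: (H y%:E z%:E); rewrite ?lee_fin ?lte_fin// psi_strict leey.
Qed.

Lemma generator_gt0 (y : R) : 0 <= y -> 0 < psi y.
Proof.
case: psi_gen => _ _ _ _ H y0.
by apply: (H y%:E +oo%E); rewrite ?lee_fin ?ltry// psi_strict leey.
Qed.

Lemma generator_bounds (y : R) : 0 <= y -> 0 <= psi y <= 1.
Proof. by case: psi_gen => + _ _ _ _ => /[apply]. Qed.

Lemma varphi_generator (r : R) : 0 <= r -> varphi psi (psi r) = r%:E.
Proof.
move=> r0; rewrite /varphi.
suff -> : [set z | (0%R <= z)%E /\ ext0 psi z = psi r] = [set r%:E].
  by rewrite ereal_inf1.
apply/seteqP; split => [z [z0 zr]|z ->]; last by rewrite /= lee_fin.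
case: z z0 zr => [z||//] /=; last first.
  by move=> _ /eqP; rewrite lt_eqF// generator_gt0.
rewrite lee_fin => z0 zr; congr _%:E.
have [zr'|rz|//] := ltgtP z r.
  by have := generator_lt z0 zr'; rewrite zr ltxx.
by have := generator_lt r0 rz; rewrite zr ltxx.
Qed.

Lemma generator_onto (t : R) : 0 < t <= 1 -> exists2 r, 0 <= r & psi r = t.
Proof.
move=> /andP[t0 t1]; have [_ psic _ [psi0 psiy] _] := psi_gen.
have [T T0 fT] : exists2 T, 0 < T & psi T < t.
  near (pinfty_nbhs R) => T; exists T.
    by near: T; apply: nbhs_pinfty_gt; exact: num_real.
  by near: T; apply: (cvgr_lt _ psiy).
have [|||c] := @IVT R psi 0 T t; first exact: ltW.
- apply: continuous_subspaceW psic => x /=.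
  by rewrite !in_itv/= => /andP[-> _].
- rewrite psi0 minC maxC; have T1 := ltW (lt_le_trans fT t1).
  by rewrite (min_idPl T1) (max_idPr T1) (ltW fT).
by rewrite in_itv/= => /andP[c0 _] <-; exists c.
Unshelve. all: by end_near. Qed.

(** The inverse as a real number; the junk value of [fine] occurs only at points
    outside the range of [psi]. *)
Definition invgen (t : R) : R := fine (varphi psi t).

Lemma invgen_itv (t : R) : 0 < t <= 1 ->
  [/\ 0 <= invgen t, psi (invgen t) = t & varphi psi t = (invgen t)%:E].
Proof.
by move=> /generator_onto[r r0 <-]; rewrite /invgen varphi_generator.
Qed.

Lemma invgen_gt0 (t : R) : 0 < t < 1 -> 0 < invgen t.
Proof.
move=> /andP[t0 t1]; have := @invgen_itv t; rewrite t0 ltW// => -[//|r0 rt _].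
rewrite lt_neqAle r0 andbT eq_sym; apply/eqP => r00; move: t1.
by case: psi_gen => _ _ _ [psi0 _] _; rewrite -rt r00 psi0 ltxx.
Qed.

Lemma generator_lt1 (r : R) : 0 < r -> 0 < psi r < 1.
Proof.
move=> r0; rewrite generator_gt0 ?ltW//=.
by have [_ _ _ [<- _] _] := psi_gen; exact: generator_lt.
Qed.

End generator.

Lemma archimedean_copula_generator (R : realType) (d : nat) (C : ('I_d -> R) -> R)
    (psi : R -> R) (z : 'I_d -> R) :
  archimedean_copula C psi -> strict_generator psi -> (forall i, 0 <= z i) ->
  C (fun i => psi (z i)) = psi (\sum_(i < d) z i).
Proof.
move=> [_ gen CE] st z0; rewrite CE; last by move=> i; exact: generator_bounds.
under eq_bigr do rewrite varphi_generator//.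
by rewrite sumEFin.
Qed.

(** The box has upper corner [psi (s / d)] in every coordinate and lower corner
    [psi (s / d + h i)], so that the arguments of [psi] add up to [s] plus the
    steps taken. *)
Lemma archimedean_survival (R : realType) (d : nat) (C : ('I_d -> R) -> R)
    (psi : R -> R) : (0 < d)%N ->
  archimedean_copula C psi -> strict_generator psi -> survival d psi.
Proof.
move=> d0 arch st; have [[_ _ boxC] gen _] := arch.
split; [|by move=> s s0; exact: generator_gt0 (ltW s0)|by case: gen => _ _ _ []].
move=> hs hsd /allP hs0 s s0.
pose h (i : 'I_d) := nth 0 hs i.
have h0 i : 0 < h i by apply: hs0; rewrite mem_nth// hsd.
have -> : hs = map h (enum 'I_d).
  by rewrite (map_comp (nth 0 hs) val) val_enum_ord -hsd; exact/esym/mkseq_nth.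
rewrite foldr_fdiff_setE ?enum_uniq//.
pose b := s / d%:R.
have dR : 0 < d%:R :> R by rewrite ltr0n.
have b0 : 0 < b by rewrite divr_gt0.
have zle i : 0 <= b + h i by rewrite ltW// addr_gt0.
have := boxC (fun i => psi (b + h i)) (fun=> psi b).
case: (gen) => bnd _ mono _ _.
move=> /(_ (fun i => bnd _ (zle i)) (fun i => bnd _ (ltW b0))).
have le i : psi (b + h i) <= psi b.
  by apply: mono; rewrite ?ltW// ltrDl.
move=> /(_ le); rewrite /box_volume; congr (_ <= _).
apply: eq_big => [A|A _].
  by apply/esym/fintype.subsetP => i _; rewrite mem_enum.
congr (_ * _).
transitivity (C (fun i => psi (b + (if i \in A then h i else 0)))).
  by congr C; apply/funext => i; case: ifP => _; rewrite ?addr0.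
rewrite (archimedean_copula_generator arch st); last first.
  by move=> i; case: ifP => // _; rewrite addr0 ltW.
rewrite big_split/= sumr_const card_ord -big_mkcond/= /b.
by rewrite -[_ / _ *+ _]mulr_natr divfK// gt_eqF.
Qed.

(** The increments of a convex nonincreasing function shrink to the right.  For a
    generator this is the 1-Lipschitz property of its copula, read in the
    coordinates [y], [z]. *)
Lemma survival_lipschitz_add (R : realType) (k : nat) (f : R -> R) (y r z : R) :
  survival k.+2 f -> 0 < y -> 0 < r -> 0 <= z ->
  `|f (y + z) - f (r + z)| <= `|f y - f r|.
Proof.
move=> fk; wlog yr : y r / y < r => [H|] y0 r0 z0.
  have [yr|ry|->] := ltgtP y r; [exact: H| |by rewrite !subrr].
  by rewrite distrC [leRHS]distrC; exact: H.
have f2 : alternating 2 f by exact: survival_alternating fk _.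
have ry0 : 0 < r - y by rewrite subr_gt0.
have yz : y <= y + z by rewrite lerDl.
have := alternating2_ge f2 ry0 y0 yz; rewrite /fdiff.
rewrite subrKC addrAC subrKC => H.
rewrite !ger0_norm ?subr_ge0//; apply: (survival_le fk) => //; try exact: ltW.
  exact: ltr_wpDr.
by rewrite lerD2r ltW.
Qed.

(** * Convergence of the generators *)

(** Halving 1 repeatedly and adding up copies of the result gives all positive
    dyadic numbers. *)
Lemma dense_add_half (R : realType) (S : R -> Prop) :
  S 1 -> (forall y z, 0 < y -> 0 < z -> S y -> S z -> S (y + z)) ->
  (forall z, 0 < z -> S z -> S (z / 2)) ->
  forall z e, 0 < z -> 0 < e -> exists a b,
    [/\ 0 < a, S a, S b, a <= z <= b & a > z - e /\ b < z + e].
Proof.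
move=> S1 SD Sh z e z0 e0.
have pow m : 0 < (2 ^+ m : R)^-1 /\ S (2 ^+ m)^-1.
  elim: m => [|m [IH1 IH2]]; first by rewrite expr0 invr1.
  by split; rewrite exprSr invfM ?divr_gt0//; exact: Sh.
have mul k m : 0 < k.+1%:R * (2 ^+ m : R)^-1 /\ S (k.+1%:R * (2 ^+ m)^-1).
  elim: k => [|k [IH1 IH2]]; first by rewrite mul1r.
  have [pow0 powS] := pow m.
  by rewrite -natr1 mulrDl mul1r; split; [rewrite addr_gt0|exact: SD].
pose c := Num.min z e.
have c0 : 0 < c by rewrite lt_min z0.
pose m := (Num.truncn c^-1).+1.
have [q0 _] := pow m; set q := (2 ^+ m)^-1 in q0.
have qc : q < c.
  rewrite /q invf_plt ?posrE ?exprn_gt0//.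
  apply: (lt_trans (truncnS_gt _)); rewrite -natrX ltr_nat.
  exact: ltn_expl.
have qz : q < z by apply: lt_le_trans qc _; rewrite ge_min lexx.
have qe : q < e by apply: lt_le_trans qc _; rewrite ge_min lexx orbT.
have /andP[k1 k2] := truncn_itv (ltW (divr_gt0 z0 q0)).
(* The dyadic number just below [z] is positive because [q < z]. *)
case: (Num.truncn _) k1 k2 => [|k].
  by rewrite ltr_pdivrMr// mul1r => _; rewrite ltNge ltW.
rewrite ler_pdivlMr// ltr_pdivrMr// => k1 k2.
have k3 : k.+2%:R * q = k.+1%:R * q + q by rewrite -natr1 mulrDl mul1r.
have [A1 A2] := mul k m; have [B1 B2] := mul k.+1 m.
exists (k.+1%:R * q), (k.+2%:R * q); split => //; first by rewrite k1 ltW.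
by rewrite k3; rewrite k3 in k2; split; lra.
Qed.

(** The last hypothesis is the convergence of the bivariate margins of the copulas
    at the point [(psi y, psi z)].  With [r] and [t] the preimages of [psi y] and
    [psi z] under [psi_ n], the sum [y + z] is reached by moving [(r, t)] to
    [(y, z)] one coordinate at a time, at the cost of [`|psi_ n y - psi y|] and
    [`|psi_ n z - psi z|].  For [z / 2], let [r] be the preimage of
    [psi (z / 2 - h)]: in the limit [psi_ n (r + r)] is above [psi_ n z], so
    [r < z / 2] and [psi_ n (z / 2) <= psi (z / 2 - h)]; likewise for
    [z / 2 + h]. *)
Lemma generator_cvg (R : realType) (k : nat) (psi_ : nat -> R -> R) (psi : R -> R) :
  is_generator psi -> strict_generator psi -> survival k.+2 psi ->
  (forall n, is_generator (psi_ n)) -> (forall n, strict_generator (psi_ n)) ->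
  (forall n, survival k.+2 (psi_ n)) ->
  normalized_generator psi -> (forall n, normalized_generator (psi_ n)) ->
  (forall y z, 0 < y -> 0 < z ->
    psi_ n (invgen (psi_ n) (psi y) + invgen (psi_ n) (psi z)) @[n --> \oo]
      --> psi (y + z)) ->
  forall z, 0 < z -> psi_ n z @[n --> \oo] --> psi z.
Proof.
move=> gen st sv gen_ st_ sv_ nm nm_ H.
have lt1 := generator_lt1 gen st.
have inv y (n : nat) : 0 < y -> 0 < invgen (psi_ n) (psi y) /\
    psi_ n (invgen (psi_ n) (psi y)) = psi y.
  move=> y0; have := lt1 _ y0 => y1; split; first exact: invgen_gt0.
  have /andP[l0 l1] := y1.
  by have := @invgen_itv _ _ (gen_ n) (st_ n) (psi y); rewrite l0 ltW// => -[].
(* Sums: the coordinates [(r, t)] with known limit are moved to [(y, z)]. *)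
have SD y z : 0 < y -> 0 < z -> psi_ n y @[n --> \oo] --> psi y ->
    psi_ n z @[n --> \oo] --> psi z -> psi_ n (y + z) @[n --> \oo] --> psi (y + z).
  move=> y0 z0 Hy Hz; apply/cvgrPdist_lt => e e0.
  have e3 : 0 < e / 3 by lra.
  have /cvgrPdist_lt/(_ _ e3) Hy' := Hy; have /cvgrPdist_lt/(_ _ e3) Hz' := Hz.
  have /cvgrPdist_lt/(_ _ e3) HH := H _ _ y0 z0.
  near=> n.
  have M1 : `|psi (y + z) - psi_ n (invgen (psi_ n) (psi y)
    + invgen (psi_ n) (psi z))| < e / 3 by near: n.
  have [r0 rE] := inv y n y0; have [t0 tE] := inv z n z0.
  set r := invgen _ (psi y) in M1 r0 rE; set t := invgen _ (psi z) in M1 t0 tE.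
  have L1 := survival_lipschitz_add (sv_ n) r0 y0 (ltW t0).
  have L2 := survival_lipschitz_add (sv_ n) t0 z0 (ltW y0).
  have M2 : `|psi y - psi_ n y| < e / 3 by near: n.
  have M3 : `|psi z - psi_ n z| < e / 3 by near: n.
  rewrite rE in L1; rewrite tE in L2.
  have -> : psi (y + z) - psi_ n (y + z) = (psi (y + z) - psi_ n (r + t)) +
      (psi_ n (r + t) - psi_ n (y + t)) + (psi_ n (t + y) - psi_ n (z + y)).
    by rewrite [t + y]addrC [z + y]addrC; ring.
  apply: le_lt_trans (ler_normD _ _) _; have := ler_normD (psi (y + z) - psi_ n (r + t)) (psi_ n (r + t) - psi_ n (y + t)).
  lra.
(* Halves: points slightly below and above [z / 2] are compared through the
   values of [psi_ n] at their doubles, separated by [mA] and [mB]. *)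
have Sh z : 0 < z -> psi_ n z @[n --> \oo] --> psi z ->
    psi_ n (z / 2) @[n --> \oo] --> psi (z / 2).
  move=> z0 Hz; apply/cvgrPdist_lt => e e0.
  have z2 : 0 < z / 2 by lra.
  have [h [h0 hs]] := continuous_bracket (survival_continuous sv z2) z2 e0.
  rewrite !ltr_norml => /andP[B1 B2] /andP[A1 A2].
  have a0 : 0 < z / 2 - h by lra.
  have b0 : 0 < z / 2 + h by lra.
  pose Da := psi (z / 2 - h + (z / 2 - h)); pose Db := psi (z / 2 + h + (z / 2 + h)).
  have DA : psi z < Da by apply: (survival_lt sv); lra.
  have DB : Db < psi z by apply: (survival_lt sv); lra.
  pose mA := (psi z + Da) / 2. pose mB := (psi z + Db) / 2.
  near=> n.
  have [ra0 raE] := inv _ n a0; have [rb0 rbE] := inv _ n b0.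
  have N1 : psi_ n z < mA by near: n; apply: (cvgr_lt _ Hz); rewrite /mA; lra.
  have N2 : mB < psi_ n z by near: n; apply: (cvgr_gt _ Hz); rewrite /mB; lra.
  have N3 : mA < psi_ n (invgen (psi_ n) (psi (z / 2 - h)) + invgen (psi_ n) (psi (z / 2 - h))).
    by near: n; apply: (cvgr_gt _ (H _ _ a0 a0)); rewrite /mA -/Da; lra.
  have N4 : psi_ n (invgen (psi_ n) (psi (z / 2 + h)) + invgen (psi_ n) (psi (z / 2 + h))) < mB.
    by near: n; apply: (cvgr_lt _ (H _ _ b0 b0)); rewrite /mB -/Db; lra.
  have La : invgen (psi_ n) (psi (z / 2 - h)) < z / 2.
    rewrite ltNge; apply/negP => P.
    have := @survival_le _ _ _ z (invgen (psi_ n) (psi (z / 2 - h)) + invgen (psi_ n) (psi (z / 2 - h))) (sv_ n) z0.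
    lra.
  have Lb : z / 2 < invgen (psi_ n) (psi (z / 2 + h)).
    rewrite ltNge; apply/negP => P.
    have := @survival_le _ _ _ (invgen (psi_ n) (psi (z / 2 + h)) + invgen (psi_ n) (psi (z / 2 + h))) z (sv_ n).
    lra.
  have := survival_le (sv_ n) ra0 (ltW La); rewrite raE.
  have := survival_le (sv_ n) z2 (ltW Lb); rewrite rbE.
  rewrite ltr_norml; lra.
have S1 : psi_ n 1 @[n --> \oo] --> psi 1.
  rewrite nm; under eq_fun do rewrite nm_; exact: cvg_cst.
move=> z z0; apply/cvgrPdist_lt => e e0.
have e2 : 0 < e / 2 by lra.
have [h [h0 hz]] := continuous_bracket (survival_continuous sv z0) z0 e2.
rewrite !ltr_norml => /andP[B1 B2] /andP[A1 A2].
have [a [b [a0 Sa Sb /andP[az zb] [ah bh]]]] :=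
  @dense_add_half R (fun z => psi_ n z @[n --> \oo] --> psi z) S1 SD Sh z h z0 h0.
have zh0 : 0 < z - h by lra.
have A3 := survival_le sv zh0 (ltW ah).
have B3 := survival_le sv (lt_le_trans z0 zb) (ltW bh).
near=> n.
have N1 : psi_ n a < psi a + e / 2 by near: n; apply: (cvgr_lt _ Sa); lra.
have N2 : psi b - e / 2 < psi_ n b by near: n; apply: (cvgr_gt _ Sb); lra.
have := survival_le (sv_ n) a0 az; have := survival_le (sv_ n) z0 zb.
rewrite ltr_norml; lra.
Unshelve. all: by end_near. Qed.

(** The copulas are evaluated at [(psi y, psi z, 1, .., 1)], where the inverse
    generators vanish at the coordinates 1. *)
Lemma archimedean_pair_cvg (R : realType) (d : nat)
    (Cpsi : ('I_d -> R) -> R) (psi : R -> R)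
    (C_ : nat -> ('I_d -> R) -> R) (psi_ : nat -> R -> R) (y z : R) :
  (1 < d)%N ->
  archimedean_copula Cpsi psi -> strict_generator psi ->
  (forall n, archimedean_copula (C_ n) (psi_ n)) ->
  (forall n, strict_generator (psi_ n)) ->
  (forall x : 'I_d -> R, in_cube x -> C_ n x @[n --> \oo] --> Cpsi x) ->
  0 < y -> 0 < z ->
  psi_ n (invgen (psi_ n) (psi y) + invgen (psi_ n) (psi z)) @[n --> \oo]
      --> psi (y + z).
Proof.
move=> d1 arch st arch_ st_ CC y0 z0; have [_ gen _] := arch.
have gen_ n : is_generator (psi_ n) by case: (arch_ n).
have psi01 (p : R -> R) : is_generator p -> p 0 = 1 by case=> _ _ _ [].
pose i0 : 'I_d := Ordinal (ltnW d1); pose i1 : 'I_d := Ordinal d1.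
pose pt (T : Type) (a b c : T) (i : 'I_d) := if i == i0 then a else if i == i1 then b else c.
have sum_pt (a b : R) : \sum_(i < d) pt R a b 0 i = a + b.
  rewrite (bigD1 i0)//= (bigD1 i1)//= big1 ?addr0 /pt ?eqxx//.
  by move=> i /andP[/negPf-> /negPf->].
have ptE (p : R -> R) (a b : R) : is_generator p ->
    (fun i => p (pt R a b 0 i)) = pt R (p a) (p b) 1.
  by move=> gp; apply/funext => i; rewrite /pt; do 2 case: ifP => // _; exact: psi01.
have pt_ge0 (a b : R) i : 0 <= a -> 0 <= b -> 0 <= pt R a b 0 i.
  by move=> a0 b0; rewrite /pt; do 2 case: ifP => // _.
have P (p : R -> R) C a b : archimedean_copula C p -> strict_generator p -> 0 <= a -> 0 <= b ->
    C (pt R (p a) (p b) 1) = p (a + b).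
  move=> ap sp a0 b0; have [_ gp _] := ap.
  rewrite -ptE// (archimedean_copula_generator ap sp) ?sum_pt// => i.
  exact: pt_ge0.
have := CC (pt R (psi y) (psi z) 1).
have /andP[p0 p1] := generator_lt1 gen st y0; have /andP[q0 q1] := generator_lt1 gen st z0.
have cube : in_cube (pt R (psi y) (psi z) 1).
  by move=> i; rewrite /pt; case: ifP => _; [lra|case: ifP => _; lra].
move=> /(_ cube); rewrite (P psi)//; try exact: ltW.
suff -> : (fun n => C_ n (pt R (psi y) (psi z) 1)) =
  (fun n => psi_ n (invgen (psi_ n) (psi y) + invgen (psi_ n) (psi z))) by [].
apply/funext => n.
have [|A1 A2 _] := @invgen_itv _ _ (gen_ n) (st_ n) (psi y); first by lra.
have [|B1 B2 _] := @invgen_itv _ _ (gen_ n) (st_ n) (psi z); first by lra.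
by rewrite -{1}A2 -{1}B2 (P (psi_ n)).
Qed.

(** * Conditional copulas in terms of derivatives of the generator *)

Section conditional_copula.
Variables (R : realType) (psi : R -> R) (k l : nat) (x : 'I_l -> R).
Hypothesis psi_gen : is_generator psi.
Hypothesis psi_strict : strict_generator psi.
Hypothesis psi_surv : survival (l + k.+2) psi.
Hypothesis l_gt0 : (0 < l)%N.
Hypothesis hx : in_open_cube x.

Let f := signed_derive l psi.
Let fS : survival k.+2 f. Proof. exact: survival_signed_derive. Qed.

Definition cond_level : R := \sum_(i < l) invgen psi (x i).
Local Notation S := cond_level.

Lemma sum_varphi_cond : (\sum_(i < l) varphi psi (x i))%E = S%:E.
Proof.
rewrite -sumEFin; apply: eq_bigr => i _.
have /andP[x0 x1] := hx i.
by have [|_ _ ->] := @invgen_itv _ _ psi_gen psi_strict (x i); rewrite ?x0 ?ltW.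
Qed.

Lemma cond_level_gt0 : 0 < S.
Proof.
rewrite /cond_level (bigD1 (Ordinal l_gt0))//= ltr_pwDl ?invgen_gt0//.
by apply: sumr_ge0 => i _; rewrite ltW// invgen_gt0.
Qed.

Let fS_gt0 : 0 < f S. Proof. by case: fS => _ fpos _; exact/fpos/cond_level_gt0. Qed.

Lemma derive1n_ratio (z : \bar R) :
  ext0 (derive1n l psi) z / ext0 (derive1n l psi) S%:E = ext0 f z / f S.
Proof.
have E s : derive1n l psi s = (-1) ^+ l * f s by rewrite /f /signed_derive signrMK.
case: z => [z||] /=; rewrite ?mul0r// !E.
rewrite invfM mulrACA divff ?mul1r//.
by rewrite expf_neq0// oppr_eq0 oner_neq0.
Qed.

Lemma kernel_marginE (y : R) : kernel_margin psi x y =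
  ext0 f (S%:E + varphi psi y)%E / f S.
Proof. by rewrite /kernel_margin sum_varphi_cond derive1n_ratio. Qed.

Lemma kernel_margin0 : kernel_margin psi x 0 = 0.
Proof. by rewrite kernel_marginE psi_strict /= mul0r. Qed.

Lemma kernel_margin_psi (v : R) : 0 <= v ->
  kernel_margin psi x (psi v) = f (S + v) / f S.
Proof. by move=> v0; rewrite kernel_marginE varphi_generator. Qed.

Lemma kernel_margin_invP (u : R) : 0 <= u <= 1 ->
  0 <= kernel_margin_inv psi x u <= 1 /\
  kernel_margin psi x (kernel_margin_inv psi x u) = u.
Proof.
have surj : set_surj `[0, 1] `[0, 1] (kernel_margin psi x).
  move=> t /=; rewrite in_itv/= => /andP[t0 t1].
  move: t0; rewrite le_eqVlt => /predU1P[<-|t0].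
    by exists 0; [rewrite /= in_itv/= lexx ler01|exact: kernel_margin0].
  have [|v v0 vE] := survival_onto fS cond_level_gt0 (u := t); first by rewrite t0.
  exists (psi v); first by rewrite /= in_itv; exact: generator_bounds.
  by rewrite kernel_margin_psi// vE mulfK// gt_eqF.
move=> u01; have uI : u \in `[0, 1]%classic by rewrite inE/= in_itv.
split; last exact: surjpK surj _ uI.
have : `[0, 1]%classic (kernel_margin_inv psi x u).
  apply: (surjpinv_image_sub (dflt := fun=> 0) surj).
  by exists u => //; rewrite /= in_itv.
by rewrite /= in_itv.
Qed.

(** The margin is positive at every [y > 0] because [f] is positive, so 0 is the
    only preimage of 0. *)
Lemma kernel_margin_inv0 : kernel_margin_inv psi x 0 = 0.
Proof.
have [|/andP[y0 y1]] := @kernel_margin_invP 0; first by rewrite lexx ler01.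
set y := kernel_margin_inv psi x 0 in y0 y1 *.
move: y0; rewrite le_eqVlt => /predU1P[<-//|y0].
have [|v0 vE _] := @invgen_itv _ _ psi_gen psi_strict y; first by rewrite y0.
rewrite -vE kernel_margin_psi// => /eqP; rewrite gt_eqF// divr_gt0//.
by case: fS => _ fpos _; apply: fpos; rewrite ltr_pwDl// cond_level_gt0.
Qed.

Lemma kernel_margin_inv_gt0 (u : R) : 0 < u <= 1 ->
  exists v, [/\ 0 <= v, varphi psi (kernel_margin_inv psi x u) = v%:E
    & f (S + v) = u * f S].
Proof.
move=> /andP[u0 u1]; have [|/andP[y0 y1]] := @kernel_margin_invP u; first by rewrite ltW.
set y := kernel_margin_inv psi x u in y0 y1 *.
move: y0; rewrite le_eqVlt => /predU1P[<-|y0].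
  by rewrite kernel_margin0 => u00; move: u0; rewrite -u00 ltxx.
have [|v0 vE vP] := @invgen_itv _ _ psi_gen psi_strict y; first by rewrite y0.
rewrite -{1}vE kernel_margin_psi// => fu.
by exists (invgen psi y); split => //; rewrite -fu divfK// gt_eqF.
Qed.

Lemma conditional_copula0 (m : nat) (u : 'I_m -> R) (j : 'I_m) :
  in_cube u -> u j = 0 -> conditional_copula psi x u = 0.
Proof.
move=> hu uj; rewrite /conditional_copula /markov_kernel sum_varphi_cond.
rewrite derive1n_ratio; suff -> : (\sum_(i < m) varphi psi
    (kernel_margin_inv psi x (u i)))%E = +oo%E by rewrite /= mul0r.
apply/eqP; rewrite esum_eqy.
  by apply/existsP; exists j; rewrite uj kernel_margin_inv0 psi_strict.
move=> i _; rewrite gt_eqF//; apply: (lt_le_trans ltNy0).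
by apply: le_ereal_inf_tmp => z [].
Qed.

Lemma conditional_copulaE (m : nat) (u v : 'I_m -> R) :
  (forall j, varphi psi (kernel_margin_inv psi x (u j)) = (v j)%:E) ->
  conditional_copula psi x u = f (S + \sum_(j < m) v j) / f S.
Proof.
move=> uv; rewrite /conditional_copula /markov_kernel sum_varphi_cond.
by rewrite derive1n_ratio; under eq_bigr do rewrite uv; rewrite sumEFin.
Qed.

End conditional_copula.

(** * The theorem *)

Lemma sum_cvg (R : realType) (m : nat) (v_ : nat -> 'I_m -> R) (v : 'I_m -> R) :
  (forall j, v_ n j @[n --> \oo] --> v j) ->
  \sum_(j < m) v_ n j @[n --> \oo] --> \sum_(j < m) v j.
Proof.
by move=> vv; apply: (@cvg_big _ _ _ _ _ _ _ _ _ (fun j n => v_ n j)) => //;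
  exact: add_continuous.
Qed.

Theorem theorem6p6 (R : realType) (d : nat)
    (Cpsi : ('I_d -> R) -> R) (psi : R -> R)
    (C_ : nat -> ('I_d -> R) -> R) (psi_ : nat -> R -> R)
    (Cpsi_arch : archimedean_copula Cpsi psi)
    (psi_strict : strict_generator psi)
    (psi_norm : normalized_generator psi)
    (C_arch : forall n, archimedean_copula (C_ n) (psi_ n))
    (psi_n_strict : forall n, strict_generator (psi_ n))
    (psi_n_norm : forall n, normalized_generator (psi_ n))
    (C_cvg : forall x : 'I_d -> R, in_cube x ->
       C_ n x @[n --> \oo] --> Cpsi x)
    (l : nat) (l_ge1 : (1 <= l)%N) (l_le : (l <= d - 2)%N)
    (x : 'I_l -> R) (hx : in_open_cube x)
    (u : 'I_(d - l) -> R) (hu : in_cube u) :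
  conditional_copula (psi_ n) x u @[n --> \oo] --> conditional_copula psi x u.
Proof.
have [k dE] : exists k, d = (l + k.+2)%N by exists (d - 2 - l)%N; lia.
have d1 : (1 < d)%N by lia.
have [_ gen _] := Cpsi_arch.
have gen_ n : is_generator (psi_ n) by case: (C_arch n).
have sv : survival (l + k.+2) psi.
  by rewrite -dE; exact: archimedean_survival (ltnW d1) Cpsi_arch _.
have sv_ n : survival (l + k.+2) (psi_ n).
  by rewrite -dE; exact: archimedean_survival (ltnW d1) (C_arch n) _.
have sv2 : survival (l + k).+2 psi by rewrite -addnS -addnS.
have sv2_ n : survival (l + k).+2 (psi_ n) by rewrite -addnS -addnS.
have psi_cvg s : 0 < s -> psi_ n s @[n --> \oo] --> psi s.
  apply: (generator_cvg gen psi_strict sv2) => // y z.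
  exact: (archimedean_pair_cvg d1 Cpsi_arch psi_strict C_arch).
pose f := signed_derive l psi; pose F n := signed_derive l (psi_ n).
have fS : survival k.+2 f by exact: survival_signed_derive.
have FS n : survival k.+2 (F n) by exact: survival_signed_derive.
have fpos s : 0 < s -> 0 < f s by case: fS => _ + _; exact.
have Fle n a b : 0 < a -> a <= b -> F n b <= F n a by exact: survival_le (FS n).
have FF s : 0 < s -> F n s @[n --> \oo] --> f s by exact: signed_derive_cvg.
have Fat (s_ : nat -> R) (s : R) : 0 < s -> s_ n @[n --> \oo] --> s ->
    F n (s_ n) @[n --> \oo] --> f s.
  by move=> s0; apply: nonincreasing_cvg_at => //; exact: survival_continuous fS s0.
(* At [u j = 0] the argument of the derivative is infinite, so this case cannot be
   treated through the real numbers [v j]. *)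
have [[j uj]|u0] := pselect (exists j, u j = 0).
  rewrite (conditional_copula0 gen psi_strict sv l_ge1 hx hu uj).
  under eq_fun do rewrite (conditional_copula0 (gen_ _) (psi_n_strict _) (sv_ _) l_ge1 hx hu uj).
  exact: cvg_cst.
have u01 j : 0 < u j <= 1.
  have /andP[uj0 ->] := hu j; rewrite andbT lt_neqAle uj0 andbT eq_sym.
  by apply/eqP => uj; apply: u0; exists j.
pose S := cond_level psi x; pose S_ n := cond_level (psi_ n) x.
have S0 : 0 < S by exact: cond_level_gt0.
have S_0 n : 0 < S_ n by exact: cond_level_gt0.
have SS : S_ n @[n --> \oo] --> S.
  apply: sum_cvg => i; have xi := hx i.
  apply: (level_cvg (F := psi_) (f := psi)) => //.
  - by move=> n a b; exact: survival_le (sv2_ n).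
  - by move=> a b; exact: survival_lt sv2.
  - by move=> n; exact: invgen_gt0.
  - exact: invgen_gt0.
  have xi' : 0 < x i <= 1 by case/andP: xi => -> /ltW.
  have [_ -> _] := invgen_itv gen psi_strict xi'.
  have E n : psi_ n (invgen (psi_ n) (x i)) = x i.
    by have [] := invgen_itv (gen_ n) (psi_n_strict n) xi'.
  by under eq_fun do rewrite E; exact: cvg_cst.
have fSS : F n (S_ n) @[n --> \oo] --> f S by exact: Fat.
have /choice[v vP] j := kernel_margin_inv_gt0 gen psi_strict sv l_ge1 hx (u01 j).
have /choice[v_ v_P] n : exists w : 'I_(d - l) -> R, forall j, [/\ 0 <= w j,
    varphi (psi_ n) (kernel_margin_inv (psi_ n) x (u j)) = (w j)%:E
    & F n (S_ n + w j) = u j * F n (S_ n)].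
  have /choice[w wP] j := kernel_margin_inv_gt0 (gen_ n) (psi_n_strict n)
    (sv_ n) l_ge1 hx (u01 j).
  by exists w.
(* [S_ n + v_ n j] is the point where [F n] takes the level [u j * F n (S_ n)],
   and these levels converge. *)
have vv j : v_ n j @[n --> \oo] --> v j.
  have [vj0 _ vjE] := vP j.
  have : S_ n + v_ n j @[n --> \oo] --> S + v j.
    apply: (level_cvg (F := F) (f := f)) => //.
    - by move=> a b; exact: survival_lt fS.
    - by move=> n; have [v0 _ _] := v_P n j; rewrite ltr_pwDl.
    - by rewrite ltr_pwDl.
    have -> : f (S + v j) = u j * f S by [].
    have E n : F n (S_ n + v_ n j) = u j * F n (S_ n).
      by have [] := v_P n j.
    by under eq_fun do rewrite E; apply: cvgM => //; exact: cvg_cst.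
  move=> Svv; have -> : v j = S + v j - S by rewrite addrAC subrr add0r.
  have -> : v_^~ j = (fun n => S_ n + v_ n j - S_ n).
    by apply/funext => n; rewrite addrAC subrr add0r.
  exact: cvgB Svv SS.
rewrite (conditional_copulaE gen psi_strict hx (v := v)); last first.
  by move=> j; have [] := vP j.
have E n : conditional_copula (psi_ n) x u =
    F n (S_ n + \sum_(j < d - l) v_ n j) / F n (S_ n).
  apply: conditional_copulaE => // j; by have [] := v_P n j.
under eq_fun do rewrite E.
apply: cvgM; last by apply: cvgV => //; rewrite gt_eqF// fpos.
apply: Fat; last by apply: cvgD => //; exact: sum_cvg.
by rewrite ltr_pwDl// sumr_ge0// => j _; have [] := vP j.
Qed.
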